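(* Let $F$ be the Clifford vertex superalgebra generated by $\Phi_1,\Phi_2$ and let $\overline F=\mathrm{Ker}_F\,\Phi_2(\tfrac12)\subset F$. Then: (1) $\overline F$ is a simple vertex superalgebra. (2) $\overline F$ is strongly generated by the fields $\Phi_1(z)$ and $\partial_z\Phi_2(z)$. (3) $\overline F$ is a $C_2$-cofinite, non-rational vertex superalgebra.
   Context: Everything is over $\mathbb C$. $F$ is the universal vertex superalgebra generated by two odd fields $\Phi_i(z)=\sum_{r\in\frac12+\mathbb Z}\Phi_i(r)z^{-r-1/2}$, $i=1,2$, with anticommutators $[\Phi_i(r),\Phi_j(s)]_+=\delta_{r+s,0}\delta_{i,j}$; as a vector space $F=\bigwedge(\Phi_i(\tfrac12-n)\mid n\in\mathbb Z_{>0},\ i=1,2)$, with vacuum ${\bf 1}$. One has $\overline F=\mathrm{Ker}_F\,\Phi_2(\tfrac12)=\bigwedge(\Phi_1(-r+\tfrac12),\ \Phi_2(-r-\tfrac12)\mid r\in\mathbb Z_{>0})$, a vertex subalgebra of $F$. A vertex superalgebra $V$ is $C_2$-cofinite if $V/C_2(V)$ is finite-dimensional, where $C_2(V)=\mathrm{span}\{u_{-2}v\mid u,v\in V\}$. Non-rational means that the category of modules is not semisimple, i.e. there is a module which is not completely reducible. Strongly generated by a set of fields means spanned by normally ordered monomials in these fields and their derivatives applied to the vacuum. *)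

(* Defs.v *)
From HB Require Import structures.
From mathcomp Require Import all_boot all_order all_algebra.
From mathcomp Require Import reals complex.

Set Implicit Arguments.
Unset Strict Implicit.
Unset Printing Implicit Defensive.

Import GRing.Theory Num.Theory.
Local Open Scope ring_scope.

Section LinearAlgebra.
Variables (K : numFieldType) (V : lmodType K).
Implicit Types (S : V -> Prop) (v : V).

Definition is_subspace S : Prop :=
  S 0 /\ forall (c : K) u v, S u -> S v -> S (c *: u + v).

Definition lspan S v : Prop :=
  exists (n : nat) (c : 'I_n -> K) (w : 'I_n -> V),
    (forall i, S (w i)) /\ v = \sum_(i < n) c i *: w i.

(* The family [e], restricted to the indices satisfying [P], is a basis. *)
Definition is_basis (I : eqType) (P : pred I) (e : I -> V) : Prop :=
  (forall v, lspan (fun w => exists2 i, P i & w = e i) v) /\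
  (forall (s : seq I) (c : I -> K), uniq s -> all P s ->
     \sum_(i <- s) c i *: e i = 0 -> forall i, i \in s -> c i = 0).

End LinearAlgebra.

(* [hpart p] is the homogeneous component of parity [p], [true] being odd. *)
Record superspace (K : numFieldType) := Superspace {
  ss_carrier :> lmodType K;
  hpart : bool -> ss_carrier -> Prop;
  hpart_subspace : forall p, is_subspace (hpart p);
  hpart_decomp : forall v, exists v0 v1,
    [/\ hpart false v0, hpart true v1 & v = v0 + v1];
  hpart_disjoint : forall v, hpart false v -> hpart true v -> v = 0
}.

Definition graded_subspace (K : numFieldType) (V : superspace K)
    (S : V -> Prop) : Prop :=
  is_subspace S /\
  forall v0 v1, hpart false v0 -> hpart true v1 -> S (v0 + v1) -> S v0 /\ S v1.

(* m (m - 1) ... (m - j + 1) / j! *)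
Definition binz (K : numFieldType) (m : int) (j : nat) : K :=
  (\prod_(i < j) (m - i%:Z)%:~R) / j`!%:R.

(* The Borcherds identity, for a product a_(n) b on V and an action a_(n) c of
   V on M: for homogeneous a, b and all c, m, n, k,
     sum_j C(m,j) (a_(n+j) b)_(m+k-j) c
     = sum_j (-1)^j C(n,j) (a_(m+n-j) b_(k+j) c
                            - (-1)^n (-1)^(|a||b|) b_(n+k-j) a_(m+j) c).
   Both sums over j >= 0 have only finitely many nonzero terms, by truncation;
   the identity is therefore stated for all large enough partial sums. *)
Definition borcherds (K : numFieldType) (V M : superspace K)
    (prod : V -> int -> V -> V) (act : V -> int -> M -> M) : Prop :=
  forall (p q : bool) (a b : V) (c : M) (m n k : int),
    hpart p a -> hpart q b ->
    exists N : nat, forall J : nat, (N <= J)%N ->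
      \sum_(j < J) binz K m j *: act (prod a (n + j%:Z) b) (m + k - j%:Z) c
      = \sum_(j < J) ((-1) ^+ j * binz K n j) *:
          (act a (m + n - j%:Z) (act b (k + j%:Z) c)
           - ((-1) ^+ `|n|%N * (-1) ^+ (p && q)) *:
               act b (n + k - j%:Z) (act a (m + j%:Z) c)).

(* [nprod a n b] is a_(n) b, where Y(a, z) = sum_n a_(n) z^(-n-1). *)
Record vertexSuperalgebra (K : numFieldType) := VertexSuperalgebra {
  vsa_carrier :> superspace K;
  vac : vsa_carrier;
  nprod : vsa_carrier -> int -> vsa_carrier -> vsa_carrier;
  nprodDl : forall n (c : K) u v w,
    nprod (c *: u + v) n w = c *: nprod u n w + nprod v n w;
  nprodDr : forall n (c : K) u v w,
    nprod u n (c *: v + w) = c *: nprod u n v + nprod u n w;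
  nprod_hpart : forall p q n u v,
    hpart p u -> hpart q v -> hpart (p (+) q) (nprod u n v);
  nprod_trunc : forall u v, exists N : int, forall n, N <= n -> nprod u n v = 0;
  vac_even : hpart false vac;
  nprod_vacl : forall n v, nprod vac n v = if n == -1 then v else 0;
  nprod_vacr : forall u, nprod u (-1) vac = u;
  nprod_vacr0 : forall u n, 0 <= n -> nprod u n vac = 0;
  nprod_borcherds : borcherds nprod nprod
}.

Section VertexSuperalgebraTheory.
Variables (K : numFieldType) (V : vertexSuperalgebra K).

(* The translation operator; Y(transl u, z) is the derivative of Y(u, z). *)
Definition transl (u : V) : V := nprod u (-2) (vac V).

Definition is_ideal (I : V -> Prop) : Prop :=
  graded_subspace I /\
  forall u v n, I v -> I (nprod u n v) /\ I (nprod v n u).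

Definition simple : Prop :=
  (exists v : V, v <> 0) /\
  forall I, is_ideal I -> (forall v, I v -> v = 0) \/ (forall v, I v).

(* The vector obtained by applying to the vacuum the right-nested normally
   ordered product of the fields (d/dz)^k Y(a, z), for (k, a) in [s]. *)
Definition normal_monomial (s : seq (nat * V)) : V :=
  foldr (fun ka v => nprod (iter ka.1 transl ka.2) (-1) v) (vac V) s.

(* A field Y(a, z) is represented by the vector [a]. *)
Definition strongly_generated (S : V -> Prop) : Prop :=
  forall v, lspan (fun w => exists2 s : seq (nat * V),
    (forall ka, ka \in s -> S ka.2) & w = normal_monomial s) v.

Definition C2 : V -> Prop := lspan (fun w => exists u v, w = nprod u (-2) v).

(* The quotient by C2 is finite-dimensional: it is spanned by the classes of
   finitely many vectors. *)
Definition C2_cofinite : Prop :=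
  exists s : seq V, forall v, exists2 w, lspan (fun x => x \in s) w & C2 (v - w).

Record vmodule := VModule {
  vm_carrier :> superspace K;
  vact : V -> int -> vm_carrier -> vm_carrier;
  vactDl : forall n (c : K) u v w,
    vact (c *: u + v) n w = c *: vact u n w + vact v n w;
  vactDr : forall n (c : K) u v w,
    vact u n (c *: v + w) = c *: vact u n v + vact u n w;
  vact_hpart : forall p q n u v,
    hpart p u -> hpart q v -> hpart (p (+) q) (vact u n v);
  vact_trunc : forall u v, exists N : int, forall n, N <= n -> vact u n v = 0;
  vact_vac : forall n v, vact (vac V) n v = if n == -1 then v else 0;
  vact_borcherds : borcherds (@nprod K V) vact
}.

Definition is_submodule (M : vmodule) (N : M -> Prop) : Prop :=
  graded_subspace N /\ forall u n v, N v -> N (vact u n v).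

Definition is_irreducible (M : vmodule) (N : M -> Prop) : Prop :=
  [/\ is_submodule N, exists2 v, N v & v <> 0 &
      forall N' : M -> Prop, is_submodule N' -> (forall v, N' v -> N v) ->
        (forall v, N' v -> v = 0) \/ (forall v, N v -> N' v)].

(* M is the direct sum of a family of irreducible submodules. *)
Definition completely_reducible (M : vmodule) : Prop :=
  exists (I : eqType) (N : I -> M -> Prop),
    [/\ forall i, is_irreducible (N i),
        forall v, exists (s : seq I) (x : I -> M),
          (forall i, N i (x i)) /\ v = \sum_(i <- s) x i
      & forall (s : seq I) (x : I -> M), uniq s -> (forall i, N i (x i)) ->
          \sum_(i <- s) x i = 0 -> forall i, i \in s -> x i = 0].

Definition nonrational : Prop := exists M : vmodule, ~ completely_reducible M.

End VertexSuperalgebraTheory.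

Definition is_vsa_morphism (K : numFieldType) (V W : vertexSuperalgebra K)
    (f : V -> W) : Prop :=
  [/\ forall (c : K) u v, f (c *: u + v) = c *: f u + f v,
      forall p v, hpart p v -> hpart p (f v),
      f (vac V) = vac W
    & forall u n v, f (nprod u n v) = nprod (f u) n (f v)].

(* Odd vectors x_1, x_2 of V whose fields X_i(z) = sum_r X_i(r) z^(-r-1/2)
   satisfy [X_i(r), X_j(s)]_+ = delta_(r+s,0) delta_(i,j).  In terms of the
   modes x_(n), the operator X_i(r), r in 1/2 + Z, is (x_i)_(r-1/2). *)
Definition clifford_fields (K : numFieldType) (V : vertexSuperalgebra K)
    (x : 'I_2 -> V) : Prop :=
  (forall i, hpart true (x i)) /\
  (forall (i j : 'I_2) (m n : int) (v : V),
     nprod (x i) m (nprod (x j) n v) + nprod (x j) n (nprod (x i) m v)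
     = if (m + n + 1 == 0) && (i == j) then v else 0).

(* X_1(-k_1-1/2) X_1(-k_2-1/2) ... X_2(-l_1-1/2) X_2(-l_2-1/2) ... 1, for
   s = ([:: k_1; k_2; ...], [:: l_1; l_2; ...]); recall Negz k = -k-1. *)
Definition clifford_monomial (K : numFieldType) (V : vertexSuperalgebra K)
    (x : 'I_2 -> V) (s : seq nat * seq nat) : V :=
  foldr (fun k v => nprod (x ord0) (Negz k) v)
    (foldr (fun k v => nprod (x ord_max) (Negz k) v) (vac V) s.2) s.1.

(* The Clifford vertex superalgebra F.  [cl_universal] says that it is
   universal among the vertex superalgebras with two such fields;
   [cl_exterior] that F, as a vector space, is the exterior algebra on the
   Phi_i(1/2-n), n > 0: the strictly ordered monomials in these generators
   form a basis. *)
Record cliffordVSA (K : numFieldType) := CliffordVSA {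
  cl_vsa :> vertexSuperalgebra K;
  Phi : 'I_2 -> cl_vsa;
  cl_fields : clifford_fields Phi;
  cl_universal : forall (W : vertexSuperalgebra K) (x : 'I_2 -> W),
    clifford_fields x ->
    exists f : cl_vsa -> W,
      [/\ is_vsa_morphism f, forall i, f (Phi i) = x i
        & forall g : cl_vsa -> W,
            is_vsa_morphism g -> (forall i, g (Phi i) = x i) -> g =1 f];
  cl_exterior :
    is_basis (fun s : seq nat * seq nat => sorted ltn s.1 && sorted ltn s.2)
      (clifford_monomial Phi)
}.

Definition Phi1 (K : numFieldType) (F : cliffordVSA K) : F := Phi F ord0.
Definition Phi2 (K : numFieldType) (F : cliffordVSA K) : F := Phi F ord_max.

(* The kernel of the mode a_(0) of an odd vector a is a vertex subalgebra. *)

Section Kernel0.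
Variables (K : numFieldType) (V : vertexSuperalgebra K) (a : V).

Definition ker0 : {pred V} := fun v => nprod a 0 v == 0.

Lemma nprodr0 (u : V) n : nprod u n 0 = 0.
Proof.
have := nprodDr n (-1) u 0 0.
by rewrite scaleN1r oppr0 addr0 scaleN1r addNr.
Qed.

Lemma nprod0l (u : V) n : nprod 0 n u = 0.
Proof.
have := nprodDl n (-1) (0 : V) 0 u.
by rewrite scaleN1r oppr0 addr0 scaleN1r addNr.
Qed.

Lemma nprod_addr (u v w : V) n : nprod u n (v + w) = nprod u n v + nprod u n w.
Proof. by have := nprodDr n 1 u v w; rewrite !scale1r. Qed.

Lemma nprod_addl (u v w : V) n : nprod (u + v) n w = nprod u n w + nprod v n w.
Proof. by have := nprodDl n 1 u v w; rewrite !scale1r. Qed.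

Lemma ker0_submod_closed : submod_closed ker0.
Proof.
split; first by rewrite unfold_in nprodr0.
move=> c u v; rewrite !unfold_in => /eqP hu /eqP hv.
by rewrite nprodDr hu hv scaler0 addr0.
Qed.

HB.instance Definition _ := GRing.isSubmodClosed.Build K V ker0 ker0_submod_closed.

Record ker0_type := Ker0 { ker0_val : V; ker0_valP : ker0_val \in ker0 }.

HB.instance Definition _ := [isSub for ker0_val].
HB.instance Definition _ := [Choice of ker0_type by <:].
HB.instance Definition _ := [SubChoice_isSubLmodule of ker0_type by <:].

Hypothesis a_odd : hpart true a.

Lemma ker0_vac : vac V \in ker0.
Proof. by rewrite unfold_in nprod_vacr0. Qed.

Lemma nprod0_derivation q (b c : V) n : hpart q b ->
  nprod a 0 (nprod b n c)
  = nprod (nprod a 0 b) n c + (-1) ^+ q *: nprod b n (nprod a 0 c).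
Proof.
move=> hb.
have [N /(_ N.+1 (leqnSn N))] := @nprod_borcherds _ V true q a b c 0 0 n a_odd hb.
have bin0 j : binz K 0 j.+1 = 0.
  by rewrite /binz big_ord_recl /= subr0 mul0r mul0r.
have bin00 : binz K 0 0 = 1 by rewrite /binz big_ord0 fact0 divr1.
rewrite !big_ord_recl !big1 /=; first last.
- by move=> i _; rewrite /bump /= add1n bin0 scale0r.
- by move=> i _; rewrite /bump /= add1n bin0 mulr0 scale0r.
rewrite bin00 !subr0 !addr0 !add0r !scale1r mulr1 !expr0 mul1r scale1r => ->.
by rewrite subrK.
Qed.

Lemma ker0_hpart (v0 v1 : V) : hpart false v0 -> hpart true v1 ->
  v0 + v1 \in ker0 -> v0 \in ker0 /\ v1 \in ker0.
Proof.
move=> h0 h1; rewrite !unfold_in nprod_addr addr_eq0 => /eqP e.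
have k1 := nprod_hpart 0 a_odd h0; have k0 := nprod_hpart 0 a_odd h1.
have z : nprod a 0 v0 = 0.
  apply: hpart_disjoint => //=; rewrite e -[- _]addr0 -scaleN1r.
  by have [hz hl] := hpart_subspace V false; apply: hl.
by move: e; rewrite z => /esym/eqP; rewrite oppr_eq0 => ->; rewrite eqxx.
Qed.

Lemma ker0_nprod (u v : V) n :
  u \in ker0 -> v \in ker0 -> nprod u n v \in ker0.
Proof.
move=> hu hv; have [u0 [u1 [h0 h1 e]]] := hpart_decomp u.
have [z0 z1] : u0 \in ker0 /\ u1 \in ker0 by apply: ker0_hpart; rewrite -?e.
move: hv z0 z1; rewrite !unfold_in => /eqP hv /eqP z0 /eqP z1.
rewrite e nprod_addl nprod_addr (nprod0_derivation _ _ h0) (nprod0_derivation _ _ h1).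
by rewrite z0 z1 hv !nprod0l !nprodr0 !scaler0 !addr0.
Qed.

Definition ker0_hp (p : bool) (v : ker0_type) : Prop := hpart p (val v).

Lemma ker0_hp_subspace p : is_subspace (ker0_hp p).
Proof.
have [hz hl] := hpart_subspace V p; split; rewrite /ker0_hp ?raddf0 //.
by move=> c u v hu hv; rewrite linearP; apply: hl.
Qed.

Lemma ker0_hp_decomp v : exists v0 v1,
  [/\ ker0_hp false v0, ker0_hp true v1 & v = v0 + v1].
Proof.
have [v0 [v1 [h0 h1 e]]] := hpart_decomp (val v).
have [k0 k1] : v0 \in ker0 /\ v1 \in ker0.
  by apply: ker0_hpart => //; rewrite -e; exact: (valP v).
exists (Sub v0 k0), (Sub v1 k1); split; rewrite /ker0_hp ?SubK //.
by apply: val_inj; rewrite raddfD /= e.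
Qed.

Lemma ker0_hp_disjoint v : ker0_hp false v -> ker0_hp true v -> v = 0.
Proof. by move=> h0 h1; apply: val_inj; rewrite raddf0; apply: hpart_disjoint. Qed.

Definition ker0_superspace : superspace K :=
  Superspace ker0_hp_subspace ker0_hp_decomp ker0_hp_disjoint.

Definition ker0_prod (u : ker0_superspace) (n : int) (v : ker0_superspace) :
    ker0_superspace :=
  Sub (nprod (val u) n (val v)) (ker0_nprod n (valP u) (valP v)).

Lemma ker0_prodDl n (c : K) u v w :
  ker0_prod (c *: u + v) n w = c *: ker0_prod u n w + ker0_prod v n w.
Proof. by apply: val_inj; rewrite linearP /= nprodDl. Qed.

Lemma ker0_prodDr n (c : K) u v w :
  ker0_prod u n (c *: v + w) = c *: ker0_prod u n v + ker0_prod u n w.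
Proof. by apply: val_inj; rewrite linearP /= nprodDr. Qed.

Lemma ker0_prod_hpart p q n (u v : ker0_superspace) :
  hpart p u -> hpart q v -> hpart (p (+) q) (ker0_prod u n v).
Proof. exact: nprod_hpart. Qed.

Lemma ker0_prod_trunc u v :
  exists N : int, forall n, N <= n -> ker0_prod u n v = 0.
Proof.
have [N hN] := nprod_trunc (val u) (val v).
by exists N => n /hN e; apply: val_inj; rewrite raddf0.
Qed.

Definition ker0_one : ker0_superspace := Sub (vac V) ker0_vac.

Lemma ker0_vacl n v : ker0_prod ker0_one n v = if n == -1 then v else 0.
Proof. by apply: val_inj; rewrite /= nprod_vacl; case: ifP => // _; rewrite raddf0. Qed.

Lemma ker0_vacr u : ker0_prod u (-1) ker0_one = u.
Proof. by apply: val_inj; rewrite /= nprod_vacr. Qed.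

Lemma ker0_vacr0 u n : 0 <= n -> ker0_prod u n ker0_one = 0.
Proof. by move=> hn; apply: val_inj; rewrite /= nprod_vacr0 // raddf0. Qed.

Lemma ker0_borcherds : borcherds ker0_prod ker0_prod.
Proof.
move=> p q x y z m n k hx hy.
have [N hN] := @nprod_borcherds _ V p q _ _ (val z) m n k hx hy.
exists N => J /hN e; apply: val_inj; rewrite !raddf_sum /=.
exact: e.
Qed.

Definition ker0_vsa : vertexSuperalgebra K :=
  @VertexSuperalgebra K ker0_superspace ker0_one ker0_prod
    ker0_prodDl ker0_prodDr ker0_prod_hpart ker0_prod_trunc (vac_even V)
    ker0_vacl ker0_vacr ker0_vacr0 ker0_borcherds.

End Kernel0.

Section Fbar.
Variables (K : numFieldType) (F : cliffordVSA K).

Definition Phi2_odd : hpart true (Phi2 F) := (cl_fields F).1 ord_max.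

(* Phi_2(1/2) is the mode (Phi2)_(0). *)
Definition Fbar : vertexSuperalgebra K := ker0_vsa Phi2_odd.

Lemma Phi1_ker : Phi1 F \in ker0 (Phi2 F).
Proof.
rewrite unfold_in; apply/eqP.
have := (cl_fields F).2 ord_max ord0 0 (-1) (vac F).
by rewrite nprod_vacr (nprod_vacr0 (Phi F ord_max)) // nprodr0 addr0 andbF.
Qed.

Lemma dPhi2_ker : transl (Phi2 F) \in ker0 (Phi2 F).
Proof.
rewrite unfold_in; apply/eqP.
have := (cl_fields F).2 ord_max ord_max 0 (-2) (vac F).
by rewrite (@nprod_vacr0 _ F _ 0) // nprodr0 addr0.
Qed.

Definition Fbar_Phi1 : Fbar := Ker0 Phi1_ker.
Definition Fbar_dPhi2 : Fbar := Ker0 dPhi2_ker.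

End Fbar.

(* Main.v *)
(* Each pair X = Phi_i(-k-1/2), Y = Phi_i(k+1/2) of creation and annihilation operators
   splits v as YXv + XYv. Hence a vector killed by an annihilation operator is
   a combination of words avoiding the corresponding creation operator, and from
   any nonzero vector of F finitely many annihilation operators lead to a nonzero
   multiple of the vacuum. The modes of Fbar include all annihilation operators
   (those of Phi_2 through (T a)_(n) = -n a_(n-1)), so every nonzero
   Fbar-submodule of F contains the vacuum. This makes Fbar simple, and
   it makes F, seen as an Fbar-module, indecomposable with the proper nonzero
   submodule Fbar, hence not completely reducible. The kernel Fbar of Phi_2(1/2)
   is spanned by the words avoiding Phi_2(-1/2), which gives strong generation;
   a word with a derivative of a generator lies in C_2, since
   (T a)_(-1) = a_(-2) and the letters anticommute, and only finitely many
   square-free words have no derivative. *)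
Require Import Defs.
From mathcomp Require Import all_boot all_order all_algebra.
From mathcomp Require Import boolp reals complex.
From mathcomp Require Import zify ring.

Set Implicit Arguments.
Unset Strict Implicit.
Unset Printing Implicit Defensive.

Import GRing.Theory Num.Theory.

Local Open Scope ring_scope.
Local Open Scope complex_scope.

(** * Subspaces and linear spans *)

Section Span.
Variables (K : numFieldType) (V : lmodType K).
Implicit Types S T : V -> Prop.

Lemma is_subspaceZ S (c : K) v : is_subspace S -> S v -> S (c *: v).
Proof. by case=> h0 hl hv; rewrite -[_ *: _]addr0; apply: hl. Qed.

Lemma is_subspaceD S u v : is_subspace S -> S u -> S v -> S (u + v).
Proof. by case=> h0 hl hu hv; rewrite -[u]scale1r; apply: hl. Qed.

Lemma is_subspaceN S v : is_subspace S -> S v -> S (- v).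
Proof. by move=> hS hv; rewrite -scaleN1r; apply: is_subspaceZ. Qed.

Lemma lspan_gen S v : S v -> lspan S v.
Proof.
move=> hv; exists 1, (fun=> 1), (fun=> v); split=> //.
by rewrite big_ord1 scale1r.
Qed.

Lemma lspan_subspace S : is_subspace (lspan S).
Proof.
split.
  by exists 0, (fun=> 0), (fun=> 0); split; [case | rewrite big_ord0].
move=> c _ _ [m [a [u [hu ->]]]] [n [b [w [hw ->]]]].
exists (m + n)%N, (fun i => match split i with inl i => c * a i | inr i => b i end),
  (fun i => match split i with inl i => u i | inr i => w i end).
split=> [i|]; first by case: (split i).
rewrite big_split_ord scaler_sumr; congr (_ + _); apply: eq_bigr => i _.
  by rewrite (unsplitK (inl i)) scalerA.
by rewrite (unsplitK (inr i)).
Qed.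

(** Serves as induction on spans: the goal is read as a subspace predicate [T] and checked on
    generators only. *)
Lemma lspan_sub S T : is_subspace T -> (forall v, S v -> T v) ->
  forall v, lspan S v -> T v.
Proof.
move=> hT hST _ [n [c [w [hw ->]]]].
apply: (big_ind T); first by case: hT.
  by move=> *; apply: is_subspaceD.
by move=> i _; apply: is_subspaceZ => //; apply: hST.
Qed.

End Span.

(** * Modes of the derivatives of a field *)

Section Translation.
Variables (K : numFieldType) (V : vertexSuperalgebra K).

Lemma binz0l j : binz K 0 j = (j == 0)%:R.
Proof.
case: j => [|j]; first by rewrite /binz big_ord0 fact0 divr1.
by rewrite /binz big_ord_recl /= subr0 !mul0r.
Qed.

Lemma binzN2 j : binz K (-2) j = (-1) ^+ j * j.+1%:R.
Proof.
rewrite /binz; have -> : \prod_(i < j) ((-2 - i%:Z)%:~R : K)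
    = (-1) ^+ j * (j.+1)`!%:R.
  elim: j => [|j IH]; first by rewrite big_ord0 mul1r.
  rewrite big_ord_recr /= IH (factS j.+1) natrM exprS mulN1r mulNr.
  have -> : (-2 - j%:Z)%:~R = - j.+2%:R :> K 
    by have -> : -2 - j%:Z = - j.+2%:Z by [lia]; rewrite rmorphN.
  by rewrite mulrN -mulrA [_ * j.+2%:R]mulrC.
rewrite factS natrM !mulrA mulfK // pnatr_eq0; by rewrite -lt0n fact_gt0.
Qed.

(** Borcherds identity for [a] and the vacuum with indices $0$, $-2$, [n]. Only mode $-1$ of the
    vacuum acts, so at most one summand survives: from the first product if [n] is negative, from
    the second if it is positive, none at $0$. *)
Lemma nprod_transl p (a c : V) n : hpart p a ->
  nprod (transl a) n c = (- n)%:~R *: nprod a (n - 1) c.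
Proof.
move=> ha.
have [N /(_ (N + `|n|).+1)] :=
  @nprod_borcherds _ V p false a (vac V) c 0 (-2) n ha (vac_even V).
move/(_ ltac:(lia)); rewrite big_ord_recl big1 => [|i _]; last first.
  by rewrite binz0l scale0r.
rewrite binz0l addr0 scale1r.
have -> : -2 + (@ord0 (N + `|n|))%:Z = -2 by [].
have -> : 0 + n - (@ord0 (N + `|n|))%:Z = n by rewrite add0r subr0.
rewrite -/(transl a) => ->.
have coef j : (-1) ^+ j * binz K (-2) j = j.+1%:R.
  by rewrite binzN2 mulrA -exprMn mulrNN mulr1 expr1n mul1r.
under eq_bigr => j _ do
  rewrite coef !nprod_vacl andbF mulr1 [(-1) ^+ _]mulrNN mulr1 scale1r.
case: n => [[|m]|m].
- rewrite oppr0 scale0r big1 // => j _.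
  rewrite ifF; last by lia.
  by rewrite /= nprodr0 subr0 scaler0.
- have hm : (m < (N + m.+1).+1)%N by lia.
  rewrite (bigD1 (Ordinal hm)) //= big1 => [|j].
    rewrite ifT; last by lia.
    rewrite nprodr0 sub0r addr0 scalerN -scaleNr.
    by congr (_ *: nprod _ _ _); lia.
  rewrite -val_eqE /= => hj.
  rewrite ifF; last by lia.
  by rewrite nprodr0 subr0 scaler0.
have hm : (m < (N + m.+1).+1)%N by lia.
rewrite (bigD1 (Ordinal hm)) //= big1 => [|j].
  rewrite ifT; last by lia.
  rewrite ifF; last by lia.
  by rewrite subr0 addr0; congr (_ *: nprod _ _ _); lia.
rewrite -val_eqE /= => hj.
rewrite ifF; last by lia.
rewrite ifF; last by lia.
by rewrite nprodr0 subr0 scaler0.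
Qed.

Lemma transl_hpart p (a : V) : hpart p a -> hpart p (transl a).
Proof.
by move=> ha; rewrite -[p]addbF; apply: nprod_hpart => //; apply: vac_even.
Qed.

Lemma iter_transl_hpart p k (a : V) : hpart p a -> hpart p (iter k (@transl K V) a).
Proof. by move=> ha; elim: k => //= k; apply: transl_hpart. Qed.

Lemma nprod_iter_translN1 p k (a c : V) : hpart p a ->
  nprod (iter k (@transl K V) a) (-1) c = k`!%:R *: nprod a (Negz k) c.
Proof.
(* Each derivative lowers the mode by one, so the induction treats all negative modes at once. *)
move=> ha; have gen m : nprod (iter k (@transl K V) a) (Negz m) c
    = ((m + k)`!%:R / m`!%:R) *: nprod a (Negz (m + k)) c.
  have f0 l : l`!%:R != 0 :> K by rewrite pnatr_eq0 -lt0n fact_gt0.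
  elim: k m => [|k IH] m; first by rewrite addn0 divff // scale1r.
  rewrite /= (nprod_transl _ _ (iter_transl_hpart k ha)).
  have -> : Negz m - 1 = Negz m.+1 by lia.
  rewrite IH scalerA addSnnS; congr (_ *: _).
  have -> : (- Negz m)%:~R = m.+1%:R :> K by rewrite NegzE opprK.
  rewrite factS natrM; field.
  by rewrite f0 nat1r pnatr_eq0.
by rewrite (gen 0) add0n fact0 divr1.
Qed.

End Translation.

(** * Creation and annihilation operators on [F] *)

Section Fock.
Variables (K : numFieldType) (F : cliffordVSA K).
Implicit Types (x y : 'I_2 * nat) (w : seq ('I_2 * nat)) (u v : F).

(** One letter $(i,k)$ indexes a dual pair: mode $-k-\frac12$ of the field [Phi F i] in [cr], mode
    $k+\frac12$ in [an]. *)
Definition cr x v : F := nprod (Phi F x.1) (Negz x.2) v.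
Definition an x v : F := nprod (Phi F x.1) x.2 v.
Definition word w : F := foldr cr (vac F) w.

Definition letters (s : seq nat * seq nat) : seq ('I_2 * nat) :=
  [seq (ord0, k) | k <- s.1] ++ [seq (ord_max, k) | k <- s.2].

Lemma clifford_monomialE s : clifford_monomial (Phi F) s = word (letters s).
Proof. by rewrite /word foldr_cat !foldr_map. Qed.

Lemma addvv_eq0 v : v + v = 0 -> v = 0.
Proof.
move=> /eqP; rewrite -mulr2n -scaler_nat scaler_eq0 pnatr_eq0 /=.
by move/eqP.
Qed.

Lemma cr_cr x y v : cr x (cr y v) = - cr y (cr x v).
Proof.
apply/eqP; rewrite -addr_eq0; apply/eqP.
by rewrite (cl_fields F).2 (_ : _ == 0 = false) //; lia.
Qed.

Lemma cr_an x y v : cr x (an y v) = (if x == y then v else 0) - an y (cr x v).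
Proof.
apply/eqP; rewrite eq_sym subr_eq (cl_fields F).2 eq_sym; apply/eqP.
congr (if _ then _ else _).
case: x y => [i k] [j l] /=; rewrite xpair_eqE andbC; congr (_ && _); lia.
Qed.

Lemma an_cr x y v : an x (cr y v) = (if x == y then v else 0) - cr y (an x v).
Proof. by rewrite cr_an [x == y]eq_sym opprB addrC subrK. Qed.

Lemma an_an x v : an x (an x v) = 0.
Proof.
by apply: addvv_eq0; rewrite (cl_fields F).2 (_ : _ == 0 = false) //; lia.
Qed.

Lemma cr_sqr x v : cr x (cr x v) = 0.
Proof. by apply: addvv_eq0; rewrite {1}cr_cr addNr. Qed.

Lemma an_vac x : an x (vac F) = 0.
Proof. exact: nprod_vacr0. Qed.

(** The vacuum is the empty monomial, a member of the exterior basis. *)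
Lemma vac_neq0 : vac F <> 0.
Proof.
move=> v0; have [_ /(_ [:: ([::], [::])] (fun=> 1))] := cl_exterior F.
rewrite big_seq1 /= scale1r => /(_ isT isT v0 ([::], [::])).
by rewrite inE eqxx => /(_ isT) /eqP; rewrite oner_eq0.
Qed.

(* [an x] annihilates the letter [x], so [an x \o cr x] is the projection onto
   the span of the words avoiding [x], along that of the words containing it. *)
Lemma an_cr_word x w : an x (cr x (word w)) = if x \in w then 0 else word w.
Proof.
elim: w => [|y w IH]; first by rewrite an_cr eqxx an_vac /cr nprodr0 subr0.
rewrite inE /=; have [<-|nxy] := eqVneq x y; first by rewrite cr_sqr /an nprodr0.
have h : an x (cr x (cr y (word w))) = cr y (an x (cr x (word w))).
  rewrite cr_cr -scaleN1r /an.
  have := nprodDr x.2 (-1) (Phi F x.1) (cr y (cr x (word w))) 0.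
  rewrite nprodr0 !addr0 => ->; rewrite -/(an _ _) an_cr (negbTE nxy) sub0r.
  by rewrite scaleN1r opprK.
by rewrite h IH /=; case: ifP => // _; rewrite /cr nprodr0.
Qed.

Definition spanw (P : seq ('I_2 * nat) -> Prop) : F -> Prop :=
  lspan (fun v => exists2 w, P w & v = word w).

Lemma nprod_preim (S : F -> Prop) (a : F) n :
  is_subspace S -> is_subspace (fun v => S (nprod a n v)).
Proof.
move=> hS; split; first by rewrite nprodr0; case: hS.
by move=> c u v hu hv; rewrite nprodDr; case: hS => _; apply.
Qed.

(** If [an x v = 0], then [v = an x (cr x v)]; this projection, applied to an expansion of [v],
    kills the words containing [x] and fixes the others. *)
Lemma spanw_avoid (P : seq ('I_2 * nat) -> Prop) x v :
  an x v = 0 -> spanw P v -> spanw (fun w => P w /\ x \notin w) v.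
Proof.
move=> av hv; set Q := fun w => _.
have -> : v = an x (cr x v) by rewrite an_cr eqxx av /cr nprodr0 subr0.
move: v hv {av}; apply: lspan_sub.
  apply: (@nprod_preim (fun u => spanw Q (an x u))).
  exact: (@nprod_preim (spanw Q) _ _ (lspan_subspace _)).
move=> _ [w Pw ->]; rewrite an_cr_word; case: ifP => xw.
  by case: (@lspan_subspace _ F (fun v => exists2 w, Q w & v = word w)).
by apply: lspan_gen; exists w; rewrite // /Q xw.
Qed.

(** Moving [an x] through a word only deletes letters, so the finite alphabet [L] does not grow. *)
Lemma spanw_an (L : seq ('I_2 * nat)) x v :
  spanw (fun w => {subset w <= L}) v -> spanw (fun w => {subset w <= L}) (an x v).
Proof.
set P := fun w => _; move: v.
have sub := @lspan_subspace _ F (fun v => exists2 w, P w & v = word w).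
apply: lspan_sub; first exact: nprod_preim.
move=> _ [w Pw ->]; elim: w Pw => [|y w IH] Pw /=.
  by rewrite an_vac; case: sub.
have yL : y \in L by apply: Pw; rewrite mem_head.
have wL : P w by move=> z zw; apply: Pw; rewrite inE zw orbT.
rewrite an_cr; apply: is_subspaceD => //.
  by case: ifP => _; [apply: lspan_gen; exists w | case: sub].
apply: is_subspaceN => //; move: (IH wL); move: (an x _).
apply: lspan_sub; first exact: nprod_preim.
move=> _ [t tL ->]; apply: lspan_gen; exists (y :: t) => // z.
by rewrite inE => /predU1P[->|/tL].
Qed.

(** Induction on a finite alphabet supporting [v]. For its first letter [x], one of [v] and [an x v]
    is nonzero and killed by [an x], hence supported on the remaining letters. Over the empty
    alphabet only multiples of the vacuum are left. *)
Lemma an_closed_vac (S : F -> Prop) v :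
  is_subspace S -> (forall x u, S u -> S (an x u)) -> S v -> v <> 0 -> S (vac F).
Proof.
move=> hS San Sv v0.
have [L hL] : exists L : seq ('I_2 * nat), spanw (fun w => {subset w <= L}) v.
  have [n [c [u [hu ->]]]] := (cl_exterior F).1 v.
  have /fin_all_exists[s hs] : forall i, exists w, u i = word w.
    by move=> i; have [t _ ->] := hu i; exists (letters t);
      apply: clifford_monomialE.
  exists (flatten (codom s)), n, c, u; split=> // i; exists (s i) => // x xs.
  by apply/flattenP; exists (s i) => //; apply: codom_f.
elim: L v Sv v0 hL => [|x L IH] v Sv v0 hv.
  have [c hc] : exists c, v = c *: vac F.
    move: v hv {Sv v0}; apply: lspan_sub.
      split=> [|c _ _ [a ->] [b ->]]; first by exists 0; rewrite scale0r.
      by exists (c * a + b); rewrite scalerDl scalerA.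
    move=> _ [[|y w] hw ->]; first by exists 1; rewrite scale1r.
    by have := hw y (mem_head _ _).
  have c0 : c != 0 by apply/eqP => c0; apply: v0; rewrite hc c0 scale0r.
  by rewrite -[vac F](scalerK c0) -hc; apply: is_subspaceZ.
have step u : S u -> u <> 0 -> an x u = 0 ->
    spanw (fun w => {subset w <= x :: L}) u -> S (vac F).
  move=> Su u0 au hu; apply: (IH u) => //.
  have := spanw_avoid au hu; move: {Su u0 au hu} u; apply: lspan_sub.
    exact: lspan_subspace.
  move=> _ [w [wL xw] ->]; apply: lspan_gen; exists w => // y yw.
  have := wL y yw; rewrite inE => /predU1P[yx|//].
  by move: xw; rewrite -yx yw.
have [au|/eqP au] := eqVneq (an x v) 0; first exact: (step v).
by apply: (step (an x v)) => //; [apply: San | apply: an_an | apply: spanw_an].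
Qed.

(** The letter [(ord_max, 0)] is $\Phi_2(-\frac12)$, and its annihilation partner is the mode
    defining the kernel. *)
Lemma ker0_spanw v : v \in ker0 (Phi2 F) ->
  spanw (fun w => uniq w /\ (ord_max, 0%N) \notin w) v.
Proof.
rewrite unfold_in => /eqP hv; apply: (@spanw_avoid _ (ord_max, 0%N)) => //.
have := (cl_exterior F).1 v; move: {hv} v; apply: lspan_sub.
  exact: lspan_subspace.
move=> _ [[s1 s2] /andP[/= ss1 ss2] ->]; apply: lspan_gen.
exists (letters (s1, s2)); last exact: clifford_monomialE.
have su s : sorted ltn s -> uniq s.
  by apply: sorted_uniq; [apply: ltn_trans | apply: ltnn].
rewrite cat_uniq !map_inj_uniq ?su ?andbT //=; try by move=> ? ? [].
by apply/hasPn => _ /mapP[k _ ->]; apply/mapP => -[].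
Qed.

End Fock.

(** * Modes of [Fbar] and strong generation *)

Section FbarTheory.
Variables (K : numFieldType) (F : cliffordVSA K).
Implicit Types (x y : 'I_2 * nat) (w : seq ('I_2 * nat)).

Lemma an_Fbar x : exists (a : Fbar F) (n : int) (c : K),
  forall v, an x v = c *: nprod (val a) n v.
Proof.
case: x => i k; have [->|->] : i = ord0 \/ i = ord_max.
  by case: i => [[|[|i]] hi] //; [left | right]; apply: val_inj.
  by exists (Fbar_Phi1 F), k, 1 => v; rewrite scale1r.
(* Mode $k+1$ of $\partial\Phi_2$ is $-(k+1)$ times mode $k$ of $\Phi_2$, a nonzero factor. *)
exists (Fbar_dPhi2 F), k.+1, (- k.+1%:R)^-1 => v /=.
rewrite (nprod_transl _ _ (Phi2_odd F)) scalerA.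
have -> : (- k.+1%:Z)%:~R = - k.+1%:R :> K by rewrite rmorphN.
by rewrite mulVf ?oppr_eq0 ?pnatr_eq0 // scale1r;
  congr (nprod _ _ _); rewrite /=; lia.
Qed.

(* For [k > 0], [Phi_2(-k-1/2)] is a mode of the [(k-1)]-st derivative of
   [dPhi2]; the value at the excluded letter [(ord_max, 0)] is junk. *)
Definition gen x : nat * Fbar F :=
  if x.1 == ord0 then (x.2, Fbar_Phi1 F) else (x.2.-1, Fbar_dPhi2 F).
Definition genmode x (v : Fbar F) : Fbar F :=
  nprod (iter (gen x).1 (@transl _ (Fbar F)) (gen x).2) (-1) v.
Definition genword w : Fbar F := normal_monomial [seq gen x | x <- w].

Lemma val_iter_transl k (u : Fbar F) :
  val (iter k (@transl _ (Fbar F)) u) = iter k (@transl _ F) (val u).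
Proof. by elim: k => //= k <-. Qed.

(** For $\Phi_2$ the derivative already contained in [dPhi2] makes up for the predecessor in [gen],
    so the factor is $k!$ for both fields. *)
Lemma val_genmode x v : x != (ord_max, 0%N) ->
  val (genmode x v) = (x.2)`!%:R *: cr x (val v).
Proof.
case: x => i k nx; rewrite /genmode /gen /=.
have [i0|i0] := eqVneq i ord0.
  rewrite val_iter_transl (nprod_iter_translN1 _ _ ((cl_fields F).1 ord0)).
  by rewrite /= i0.
have {}i0 : i = ord_max.
  by apply: val_inj; case: i i0 {nx} => [[|[|i]] hi].
case: k nx => [|k _]; first by rewrite i0 eqxx.
rewrite val_iter_transl -iterSr (nprod_iter_translN1 _ _ (Phi2_odd F)).
by rewrite /= i0.
Qed.

Lemma genmode_anticomm x y v : x != (ord_max, 0%N) -> y != (ord_max, 0%N) ->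
  genmode x (genmode y v) = - genmode y (genmode x v).
Proof.
move=> hx hy; apply: val_inj; rewrite raddfN /=.
have E z t u : z != (ord_max, 0%N) -> t != (ord_max, 0%N) ->
    val (genmode z (genmode t u)) = ((z.2)`!%:R * (t.2)`!%:R) *: cr z (cr t (val u)).
  move=> hz ht; rewrite !val_genmode // -scalerA; congr (_ *: _).
  by have := nprodDr (Negz z.2) (t.2)`!%:R (Phi F z.1) (cr t (val u)) 0;
    rewrite nprodr0 !addr0.
have := E x y v hx hy; have := E y x v hy hx => /= -> ->.
by rewrite cr_cr scalerN mulrC.
Qed.

Lemma val_genword w : (ord_max, 0%N) \notin w ->
  exists2 c : K, c != 0 & val (genword w) = c *: word F w.
Proof.
elim: w => [|x w IH]; first by exists 1; rewrite ?oner_neq0 // scale1r.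
rewrite inE negb_or eq_sym => /andP[hx /IH[c c0 hc]].
exists ((x.2)`!%:R * c).
  by rewrite mulf_neq0 // pnatr_eq0 -lt0n fact_gt0.
have := val_genmode (genword w) hx; rewrite /genword /= hc -scalerA => ->.
congr (_ *: _); have := nprodDr (Negz x.2) c (Phi F x.1) (word F w) 0.
by rewrite nprodr0 !addr0.
Qed.

Lemma Fbar_genword_span (v : Fbar F) :
  lspan (fun u => exists2 w, uniq w /\ (ord_max, 0%N) \notin w & u = genword w) v.
Proof.
set H := fun u : Fbar F => _.
(* The known expansion lives in [F], so the claim is put as a predicate on [val v]. *)
suff [u /val_inj-> hu] : exists2 u : Fbar F, val v = val u & lspan H u by [].
have sub := @lspan_subspace _ _ H.
move: (val v) (ker0_spanw (valP v)); apply: lspan_sub.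
  split; first by exists 0; [rewrite raddf0 | case: sub].
  move=> c _ _ [u1 -> h1] [u2 -> h2]; exists (c *: u1 + u2).
    by rewrite linearP.
  by case: sub => _; apply.
move=> _ [w [uw nw] ->]; have [c c0 hc] := val_genword nw.
exists (c^-1 *: genword w); first by rewrite linearZ /= hc scalerA mulVf ?scale1r.
by apply: is_subspaceZ => //; apply: lspan_gen; exists w.
Qed.

Lemma Fbar_strongly_generated : @strongly_generated _ (Fbar F)
  (fun u => u = Fbar_Phi1 F \/ u = Fbar_dPhi2 F).
Proof.
move=> v; move: v (Fbar_genword_span v); apply: lspan_sub.
  exact: lspan_subspace.
move=> _ [w _ ->]; apply: lspan_gen.
exists [seq gen x | x <- w] => // _ /mapP[x _ ->].
by rewrite /gen; case: ifP; [left | right].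
Qed.

(** * $C_2$-cofiniteness *)

Lemma genmode_C2 x v : (0 < (gen x).1)%N -> C2 (genmode x v).
Proof.
rewrite /genmode; case E : (gen x) => [[|k] a] // _.
rewrite -[(_, _).1]/k.+1 -[(_, _).2]/a.
have ha : hpart true a.
  move: E; rewrite /gen; case: ifP => _ [_ <-]; first exact: (cl_fields F).1.
  exact/transl_hpart/Phi2_odd.
rewrite iterS (nprod_transl _ _ (iter_transl_hpart k ha)) opprK scale1r.
by apply: lspan_gen; exists (iter k (@transl _ (Fbar F)) a), v.
Qed.

Lemma genword_C2 w : (ord_max, 0%N) \notin w ->
  has (fun x => 0 < (gen x).1)%N w -> C2 (genword w).
Proof.
(* A letter carrying a derivative is moved to the front; [c] collects the signs. *)
move=> nw hw; suff [x [c [v [hx ->]]]] : exists x c v,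
    (0 < (gen x).1)%N /\ genword w = c *: genmode x v.
  by apply: is_subspaceZ; [apply: lspan_subspace | apply: genmode_C2].
elim: w nw hw => //= x w IH; rewrite inE negb_or eq_sym => /andP[nx nw].
rewrite -/(genmode _ _) -/(genword _).
have [hx _|_ /= hw] := boolP (0 < (gen x).1)%N.
  by exists x, 1, (genword w); rewrite scale1r.
have [y [c [v [hy e]]]] := IH nw hw; exists y, (- c), (genmode x v); split=> //.
have ny : y != (ord_max, 0%N) by apply: contraTneq hy => ->.
rewrite scaleNr -scalerN -genmode_anticomm //.
change (genmode x (genword w) = c *: genmode x (genmode y v)); rewrite e.
by have := nprodDr (-1) c (iter (gen x).1 (@transl _ (Fbar F)) (gen x).2)
    (genmode y v) 0; rewrite nprodr0 !addr0.
Qed.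

Lemma Fbar_C2_cofinite : C2_cofinite (Fbar F).
Proof.
(* $\Phi_1(-\frac12)$ and $\Phi_2(-\frac32)$ are the only admissible letters without a derivative.
   Both orders are listed because the spanning words are square-free but not sorted. *)
pose a : 'I_2 * nat := (ord0, 0%N); pose b : 'I_2 * nat := (ord_max, 1%N).
pose ws := [:: [::]; [:: a]; [:: b]; [:: a; b]; [:: b; a]].
exists [seq genword w | w <- ws] => v.
have sG := @lspan_subspace _ _ (fun x : Fbar F => x \in [seq genword w | w <- ws]).
have sC := @lspan_subspace _ (Fbar F) (fun u => exists u1 u2, u = nprod u1 (-2) u2).
move: v (Fbar_genword_span v); apply: lspan_sub.
  split; first by exists 0; rewrite ?subr0; [case: sG | case: sC].
  move=> c u1 u2 [w1 h1 k1] [w2 h2 k2]; exists (c *: w1 + w2).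
    by case: sG => _; apply.
  rewrite opprD addrACA -scalerBr; case: sC => _; exact.
move=> _ [w [uw nw] ->].
have [hw|hw] := boolP (has (fun x => 0 < (gen x).1)%N w).
  by exists 0; [case: sG | rewrite subr0; apply: genword_C2].
exists (genword w); last by rewrite subrr; case: sC.
apply: lspan_gen; apply: map_f.
have sub : {subset w <= [:: a; b]}.
  move=> [[[|[|i]] hi] k] xw //; move: (hasPn hw _ xw); rewrite /gen /= -leqNgt.
    by case: k xw => // xw _; rewrite !inE -!(inj_eq val_inj).
  case: k xw => [|[|k]] // xw _.
    move: nw; rewrite (_ : (ord_max, 0%N) = (Ordinal hi, 0%N)) ?xw //.
    by congr pair; apply: val_inj.
have := uniq_leq_size uw sub.
case: w uw sub {hw nw} => [|x [|y [|z w]]] //=.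
  by move=> _ /(_ x (mem_head _ _)); rewrite !inE => /orP[] /eqP->.
rewrite inE andbT => nxy sub _.
have := sub x (mem_head _ _); have := sub y (mem_last x [:: y]).
by rewrite !inE => /orP[] /eqP ey /orP[] /eqP ex; move: nxy; rewrite ex ey.
Qed.

(** * Simplicity *)

Lemma Fbar_simple : simple (Fbar F).
Proof.
split.
  exists (vac (Fbar F)) => /(congr1 val); rewrite raddf0; exact: vac_neq0.
move=> I [[sI _] hI].
have [[v [Iv v0]]|nI] := pselect (exists v, I v /\ v <> 0); last first.
  by left=> v Iv; apply: contrapT => v0; apply: nI; exists v.
right; suff Ivac : I (vac (Fbar F)).
  by move=> u; rewrite -[u](@nprod_vacr _ (Fbar F)); apply: (hI _ _ _ Ivac).1.
have [u e Iu] : exists2 u : Fbar F, vac F = val u & I u.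
  (* The ideal is carried to its image in [F], where annihilation operators act as modes of
     [Fbar]. *)
  apply: (@an_closed_vac _ F (fun f => exists2 u : Fbar F, f = val u & I u) (val v)).
  - split; first by exists 0; [rewrite raddf0 | case: sI].
    move=> c _ _ [u1 -> h1] [u2 -> h2]; exists (c *: u1 + u2).
      by rewrite linearP.
    by case: sI => _; apply.
  - move=> x _ [u -> Iu]; have [a [n [c hx]]] := an_Fbar x.
    exists (c *: nprod a n u); first by rewrite hx linearZ.
    by apply: is_subspaceZ => //; apply: (hI _ _ _ Iu).1.
  - by exists v.
  - by move=> e; apply: v0; apply: val_inj; rewrite e raddf0.
by rewrite (_ : vac (Fbar F) = u) //; apply: val_inj.
Qed.

(** * Non-rationality, from [F] as an [Fbar]-module *)

Lemma Fmod_actDl n (c : K) (u v : Fbar F) (m : F) :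
  nprod (val (c *: u + v)) n m = c *: nprod (val u) n m + nprod (val v) n m.
Proof. by rewrite linearP nprodDl. Qed.

Definition Fmod : vmodule (Fbar F) :=
  @VModule K (Fbar F) F (fun u n v => nprod (val u) n v) Fmod_actDl
    (fun n c u => @nprodDr K F n c (val u))
    (fun p q n u v => @nprod_hpart K F p q n (val u) v)
    (fun u => @nprod_trunc K F (val u)) (@nprod_vacl K F)
    (fun p q a b => @nprod_borcherds K F p q (val a) (val b)).

Lemma Fmod_submodule_vac (N : Fmod -> Prop) v :
  is_submodule N -> N v -> v <> 0 -> N (vac F).
Proof.
case=> [[sN _] hN]; apply: an_closed_vac => // x u Nu.
have [a [n [c ->]]] := an_Fbar x; apply: is_subspaceZ => //.
exact: (hN a).
Qed.

Lemma Fbar_submodule : is_submodule (fun v : Fmod => v \in ker0 (Phi2 F)).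
Proof.
split; last by move=> u n v; apply: ker0_nprod; [apply: Phi2_odd | apply: valP].
split.
  have [h0 hl] := ker0_submod_closed (Phi2 F).
  by split=> // c u v hu hv; apply: hl.
by move=> v0 v1 h0 h1 h; apply: (@ker0_hpart _ F _ (Phi2_odd F)) => //.
Qed.

(** $\Phi_2(\frac12)\Phi_2(-\frac12)\mathbf 1=\mathbf 1\neq 0$. *)
Lemma Phi2_notin_ker0 : Phi2 F \notin ker0 (Phi2 F).
Proof.
rewrite unfold_in; apply/eqP => h.
have := (cl_fields F).2 ord_max ord_max 0 (-1) (vac F).
rewrite nprod_vacr (nprod_vacr0 (Phi F ord_max)) // nprodr0 addr0 h.
by move/esym; apply: vac_neq0.
Qed.

Lemma Fmod_not_completely_reducible : ~ completely_reducible Fmod.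
Proof.
move=> [I [N [irr span indep]]].
have Nvac i : N i (vac F).
  by have [sub [v Nv v0] _] := irr i; apply: Fmod_submodule_vac v0.
(* Every summand contains the vacuum; two different ones would give the forbidden relation $\mathbf
   1+(-\mathbf 1)=0$. *)
have all_eq (i j : I) : i = j.
  apply/eqP; apply: contrapT => /negP nij.
  pose x k : Fmod := if k == i then vac F else if k == j then - vac F else 0.
  have Nx k : N k (x k).
    have [[[sub _] _] _ _] := irr k; rewrite /x; case: ifP => // _.
    by case: ifP => _; [apply: is_subspaceN | case: sub].
  apply: (@vac_neq0 _ F).
  have := indep [:: i; j] x; rewrite /= inE andbT !big_cons big_nil /x eqxx.
  rewrite [j == i]eq_sym (negbTE nij) eqxx addr0 subrr => /(_ isT Nx erefl i).
  by rewrite eqxx mem_head; apply.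
have [s [x [Nx e]]] := span (Phi2 F).
case: s e => [|i s] e.
  by move: Phi2_notin_ker0; rewrite e big_nil unfold_in nprodr0 eqxx.
have NPhi2 : N i (Phi2 F).
  have [[[sub _] _] _ _] := irr i; rewrite e.
  apply: (big_ind (N i)); first by case: sub.
    by move=> *; apply: is_subspaceD.
  by move=> j _; rewrite (all_eq i j).
(* The only summand contains $\Phi_2$, so its submodule [Fbar] is neither zero nor everything. *)
have [_ _ min] := irr i.
have [] := min _ Fbar_submodule.
- move=> v hv; have [[_ hN] _ _] := irr i.
  have := hN (Ker0 hv) (-1) _ (Nvac i); rewrite /= nprod_vacr; exact.
- by move/(_ _ (ker0_vac _)); apply: vac_neq0.
- by move/(_ _ NPhi2); apply/negP/Phi2_notin_ker0.
Qed.

End FbarTheory.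

Theorem proposition3p1 (R : realType) (F : cliffordVSA R[i]) :
  [/\ simple (Fbar F),
      @strongly_generated _ (Fbar F)
        (fun u => u = Fbar_Phi1 F \/ u = Fbar_dPhi2 F),
      C2_cofinite (Fbar F)
    & nonrational (Fbar F)].
Proof.
split; first exact: Fbar_simple.
- exact: Fbar_strongly_generated.
- exact: Fbar_C2_cofinite.
- by exists (Fmod F); apply: Fmod_not_completely_reducible.
Qed.
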